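(* Let $\{B_1,\dots,B_k\}$ be a finite nonempty set of graphons (a graphon basis). Then the corresponding generator space $$\Omega=\Big\{\sum_{i=1}^k\alpha_iB_i \;:\; \alpha_i\ge 0 \text{ for all } i,\ \sum_{i=1}^k\alpha_i=1\Big\}$$ is the convex hull of $\{B_1,\dots,B_k\}$.
   Context: A graphon is a (measurable) bounded symmetric function $B:[0,1]^2\to[0,1]$. A graph generator associated with a graphon basis $\{B_i\}$ is a convex combination $f(\{\alpha_i\},\{B_i\})=\sum_{i=1}^k\alpha_iB_i$ with $\alpha_i\ge0$ and $\sum_i\alpha_i=1$. The convex hull is the smallest convex set containing the $B_i$, taken in the real vector space of functions $[0,1]^2\to\mathbb R$. *)

(* Defs.v *)
From mathcomp Require Import all_boot all_order all_algebra.
From mathcomp Require Import all_classical all_reals all_analysis.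
From mathcomp Require Import measurable_realfun.

Set Implicit Arguments.
Unset Strict Implicit.
Unset Printing Implicit Defensive.

Import Order.TTheory GRing.Theory Num.Theory.
Import numFieldNormedType.Exports.

Local Open Scope classical_set_scope.
Local Open Scope ring_scope.

(* [{i01 R}] is the unit interval as a type, so [usquare R -> R^o] is the
   space of functions on the unit square itself, with its pointwise lmodType
   structure; [R^o] (convertible to [R]) makes the codomain an lmodType. *)
Definition usquare (R : realType) : Type := ({i01 R} * {i01 R})%type.

Definition usquare_val (R : realType) (p : usquare R) : R * R :=
  (p.1%:num, p.2%:num).

(* The Lebesgue sigma-algebra of the plane is the completion of the product
   (Borel) sigma-algebra: unions of a measurable set and a negligible one. *)
Definition lebesgue_measurable2 (R : realType) (A : set (R * R)) : Prop :=
  completed_algebra_gen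
    (@lebesgue_measure R \x @lebesgue_measure R)%E A.

Definition graphon (R : realType) (W : usquare R -> R^o) : Prop :=
  [/\ forall Y : set R, measurable Y ->
        lebesgue_measurable2 (@usquare_val R @` (W @^-1` Y)),
      forall x y : {i01 R}, W (x, y) = W (y, x)
    & forall p : usquare R, 0 <= W p <= 1].

Definition graph_generator (R : realType) (k : nat)
    (alpha : 'I_k -> R) (B : 'I_k -> usquare R -> R^o) : usquare R -> R^o :=
  \sum_(i < k) alpha i *: B i.

Definition generator_space (R : realType) (k : nat)
    (B : 'I_k -> usquare R -> R^o) : set (usquare R -> R^o) :=
  [set f | exists alpha : 'I_k -> R,
     [/\ forall i, 0 <= alpha i, \sum_(i < k) alpha i = 1
       & f = graph_generator alpha B]].

Definition convex_hull (R : numDomainType) (M : lmodType R) (X : set M) :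
    set M :=
  smallest (@convex_set R M) X.

(* Main.v *)
(** Finite convex combinations of the [B i] are stable under two-point convex
    combinations, because the weights combine linearly; conversely, a weighted
    sum of points of a convex set is, by induction on the number of terms, the
    total weight times a point of that set. *)
Require Import Defs.
From mathcomp Require Import all_boot all_order all_algebra.
From mathcomp Require Import all_classical all_reals all_analysis.

Local Open Scope classical_set_scope.
Local Open Scope ring_scope.

Import Order.TTheory GRing.Theory Num.Theory.

(** Trades boolean membership for plain application and exposes the module operations behind the
    convex-space structure. *)
Lemma convex_setP (R : numDomainType) (M : lmodType R) (A : set M) :
  convex_set A <-> forall (x y : M) (t : {i01 R}),
    A x -> A y -> A (t%:num *: x + (1 - t%:num) *: y).
Proof.
split=> [cA x y t Ax Ay | cA x y t /set_mem Ax /set_mem Ay].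
  by apply: set_mem; apply: cA; apply: mem_set.
by apply: mem_set; exact: cA.
Qed.

(* Factoring out the total weight instead of dividing by it keeps the induction
   valid when some partial sums of the weights vanish. *)
Lemma convex_set_wsum (R : numFieldType) (M : lmodType R) (A : set M)
    (I : Type) (r : seq I) (a : I -> R) (x : I -> M) :
  convex_set A -> A !=set0 ->
  (forall i, 0 <= a i) -> (forall i, A (x i)) ->
  exists2 y, A y & \sum_(i <- r) a i *: x i = (\sum_(i <- r) a i) *: y.
Proof.
move=> /convex_setP cA [x0 Ax0] a_ge0 Ax.
elim: r => [|i r [y Ay IHr]]; first by exists x0; rewrite // !big_nil scale0r.
rewrite !big_cons {}IHr.
have s_ge0 : 0 <= \sum_(j <- r) a j by apply: sumr_ge0.
move: (\sum_(j <- r) a j) s_ge0 => s s_ge0.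
(* Nonnegative weights with zero total both vanish, so both sides are 0 and any point of [A]
   serves. *)
have [/eqP|t_neq0] := eqVneq (a i + s) 0.
  rewrite paddr_eq0 // => /andP[/eqP -> /eqP ->].
  by exists x0; rewrite // !(addr0, scale0r).
have t_gt0 : 0 < a i + s by rewrite lt_neqAle eq_sym t_neq0 addr_ge0.
(* The new point is the barycentre of [x i] and [y] with masses [a i] and [s]; scaling by [a i + s]
   clears the denominators. *)
have w_ge0 : 0 <= a i / (a i + s) by rewrite divr_ge0 // ltW.
have w_le1 : a i / (a i + s) <= 1 by rewrite ler_pdivrMr // mul1r lerDl.
pose w := Itv01 w_ge0 w_le1.
exists (w%:num *: x i + (1 - w%:num) *: y); first exact: cA.
rewrite scalerDr !scalerA /= mulrBr mulr1 mulrCA divff // mulr1.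
by rewrite [a i + s]addrC addrK.
Qed.

Lemma generator_space_convex (R : realType) (k : nat)
    (B : 'I_k -> usquare R -> R^o) : convex_set (generator_space B).
Proof.
apply/convex_setP => _ _ t [a [a_ge0 a_sum ->]] [b [b_ge0 b_sum ->]].
exists (fun i => t%:num * a i + (1 - t%:num) * b i); split.
- by move=> i; rewrite addr_ge0 ?mulr_ge0 ?subr_ge0.
- by rewrite big_split /= -!mulr_sumr a_sum b_sum !mulr1 addrC subrK.
- rewrite /graph_generator !scaler_sumr -big_split /=.
  by apply: eq_bigr => i _; rewrite [RHS]scalerDl !scalerA.
Qed.

Lemma sub_generator_space (R : realType) (k : nat)
    (B : 'I_k -> usquare R -> R^o) : range B `<=` generator_space B.
Proof.
move=> _ [i _ <-]; exists (fun j => (j == i)%:R); split.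
- by move=> j; rewrite ler0n.
- by rewrite (bigD1 i) //= eqxx big1 ?addr0 // => j /negPf ->.
- rewrite /graph_generator (bigD1 i) //= eqxx scale1r big1 ?addr0 //.
  by move=> j /negPf ->; rewrite scale0r.
Qed.

Theorem theorem5p1 (R : realType) (k : nat) (B : 'I_k -> usquare R -> R^o)
    (k_gt0 : (0 < k)%N) (B_graphon : forall i : 'I_k, graphon (B i)) :
  generator_space B = convex_hull (range B).
Proof.
apply/seteqP; split; last first.
  apply: smallest_sub; [exact: generator_space_convex|].
  exact: sub_generator_space.
(* [smallest] is an intersection, so [A] is an arbitrary convex set containing [range B]. *)
move=> _ [a [a_ge0 a_sum ->]] A [cA BA].
have AB i : A (B i) by apply: BA; exists i.
have A_neq0 : A !=set0 by exists (B (Ordinal k_gt0)).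
have [y Ay] := @convex_set_wsum _ _ _ _ (index_enum 'I_k) a B cA A_neq0 a_ge0 AB.
by rewrite /graph_generator a_sum scale1r => ->.
Qed.
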